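(* Let $N$ be a Cartan semigroup in a C*-algebra $A$ with associated semi-Cartan subalgebra $B=C^*(N_+)$. Then for all $\alpha\in\mathbb{C}$ and $n\in N$ we have $\alpha B\cup n^*Bn\subseteq B$, and $\mathbb{C}N=N\subseteq N(B)$.
   Context: For a subset $N$ of a C*-algebra $A$, $N_+:=\{n^*n:n\in N\}$ and $C^*(N)$ is the C*-subalgebra generated by $N$. An expectation is a contractive idempotent linear map $A\to A$. $N\subseteq A$ is a Cartan semigroup if: (1) $N$ is a norm-closed *-subsemigroup of $A$ (closed under products and adjoints) with dense linear span in $A$; (2) $B:=C^*(N_+)$ is commutative and contained in $N$; (3) there is an expectation $E$ from $A$ onto $B$ with $E(n)n^*\in B$ for all $n\in N$. Then $B$ is called the associated semi-Cartan subalgebra. The normaliser semigroup of $B$ is $N(B)=\{n\in A:n^*Bn\cup nBn^*\subseteq B\}$. $\mathbb{C}N=\{\alpha n:\alpha\in\mathbb{C},n\in N\}$. *)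

(* Defs.v *)
From HB Require Import structures.
From mathcomp Require Import all_boot all_order all_algebra.
From mathcomp Require Import complex.
From mathcomp Require Import all_classical all_reals all_analysis.

Set Implicit Arguments.
Unset Strict Implicit.
Unset Printing Implicit Defensive.

Import Order.TTheory GRing.Theory Num.Theory.
Import numFieldNormedType.Exports.

Local Open Scope classical_set_scope.
Local Open Scope ring_scope.

Declare Scope cstar_scope.
Delimit Scope cstar_scope with C_star.

Reserved Notation "x ** y" (at level 40, left associativity).

(* MathComp rings all have a 1, whereas a C*-algebra need not be unital, so the
   product is a new operation on top of a complex Banach space.  Norms take
   values in the nonnegative reals of R[i], as for any normed R[i]-module. *)
HB.mixin Record CompleteNormedModule_isCstarAlgebra (R : realType) A
    of CompleteNormedModule R[i] A := {
  cmul : A -> A -> A ;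
  star : A -> A ;
  cmulA : associative cmul ;
  cmulDl : forall x y z : A, cmul (x + y) z = cmul x z + cmul y z ;
  cmulDr : forall x y z : A, cmul x (y + z) = cmul x y + cmul x z ;
  cscaleAl : forall (c : R[i]) (x y : A), c *: cmul x y = cmul (c *: x) y ;
  cscaleAr : forall (c : R[i]) (x y : A), c *: cmul x y = cmul x (c *: y) ;
  normcM_le : forall x y : A, `|cmul x y| <= `|x| * `|y| ;
  starD : forall x y : A, star (x + y) = star x + star y ;
  starZ : forall (c : R[i]) (x : A), star (c *: x) = (c^*)%R *: star x ;
  starM : forall x y : A, star (cmul x y) = cmul (star y) (star x) ;
  starK : involutive star ;
  cstar_identity : forall x : A, `|cmul (star x) x| = `|x| ^+ 2
}.

#[short(type="cstarAlgType")]
HB.structure Definition CstarAlgebra (R : realType) :=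
  {A of CompleteNormedModule_isCstarAlgebra R A & CompleteNormedModule R[i] A}.

Notation "x ** y" := (cmul x y) : cstar_scope.
Local Open Scope cstar_scope.

Section CartanSemigroups.
Context {R : realType} {A : cstarAlgType R}.
Implicit Types (M N B S : set A).

Record cstar_subalgebra M : Prop := CstarSubalgebra {
  csubalg0 : M 0 ;
  csubalgD : forall x y, M x -> M y -> M (x + y) ;
  csubalgZ : forall (c : R[i]) x, M x -> M (c *: x) ;
  csubalgM : forall x y, M x -> M y -> M (x ** y) ;
  csubalg_star : forall x, M x -> M (star x) ;
  csubalg_closed : closed M
}.

Definition cstar_generated S : set A := smallest cstar_subalgebra S.

Definition star_squares N : set A := [set star n ** n | n in N].

Definition linear_span S : set A :=
  [set x | exists (k : nat) (c : 'I_k -> R[i]) (v : 'I_k -> A),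
     (forall i, S (v i)) /\ x = \sum_(i < k) c i *: v i].

Definition cstar_expectation (E : {linear A -> A}) : Prop :=
  (forall x, `|E x| <= `|x|) /\ (forall x, E (E x) = E x).

Definition semi_cartan N : set A := cstar_generated (star_squares N).

Record cartan_semigroup N : Prop := CartanSemigroup {
  cartan_closed : closed N ;
  cartanM : forall m n, N m -> N n -> N (m ** n) ;
  cartan_star : forall n, N n -> N (star n) ;
  cartan_dense : dense (linear_span N) ;
  cartan_comm : forall a b,
    semi_cartan N a -> semi_cartan N b -> a ** b = b ** a ;
  cartan_sub : semi_cartan N `<=` N ;
  cartan_expectation : exists E : {linear A -> A},
    [/\ cstar_expectation E, range E = semi_cartan N
      & forall n, N n -> semi_cartan N (E n ** star n)]
}.

Definition sandwich (x : A) B (y : A) : set A := [set x ** b ** y | b in B].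

Definition scale_set (c : R[i]) B : set A := [set c *: b | b in B].

Definition complex_multiples N : set A :=
  [set c *: n | c in [set: R[i]] & n in N].

Definition normaliser B : set A :=
  [set n | sandwich (star n) B n `|` sandwich n B (star n) `<=` B].

End CartanSemigroups.

(* Main.v *)
Require Import Defs.
From mathcomp Require Import all_boot all_order all_algebra.
From mathcomp Require Import complex.
From mathcomp Require Import ring.
From mathcomp Require Import all_classical all_reals all_analysis.

Set Implicit Arguments.
Unset Strict Implicit.
Unset Printing Implicit Defensive.

Import Order.TTheory GRing.Theory Num.Theory.
Import numFieldNormedType.Exports.

Local Open Scope classical_set_scope.
Local Open Scope ring_scope.
Local Open Scope cstar_scope.

(** Write [B] for [semi_cartan N], the C*-algebra generated by the squares
    [n^* n] with [n] in [N].

    Stability of [B] under [b |-> n^* b n].  Fix [N] and let [T] be the set of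
    those [b] in [B] with [n^* b n] in [B] for every [n] in [N].  It contains
    the generators, because [n^* (m^* m) n = (m n)^* (m n)].  It is a C*-algebra:
    only products need an argument, and in fact every product [x y] of elements
    of [B] lies in [T].  Indeed [n^* x y n = (x^* n)^* (y n)] is by polarization
    a linear combination of squares of elements [(c x^* + d y) n], which belong
    to [N] since [B] is a linear space contained in [N].  Hence [T = B]
    (lemma [sandwich_semi_cartan]).

    Stability of [N] under scalars.  For [n] in [N], [h = n^* n] lies in [B],
    and [n] is a limit of elements [n b] with [b] in [B]
    ([approximate_unit]).  Then [c n] is the limit of the [n (c b)], which
    are in [N] because [c b] is in [B], hence in [N].

    The approximation is obtained without functional calculus, from a mean
    ergodic argument.  Put [V = 1 + (i/k) a] with [a] a real multiple of [h]
    such that [|a|^2 <= 1/2], acting by right multiplication.  Since [a] is self-adjoint,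
    [V V^* = 1 + a^2/k^2], so the first [k^2] powers of [V] are bounded by [2]
    independently of [k] ([iter_shift_by_le]).  Their mean [Y] is then bounded by
    [2], while telescoping gives [Y a = (V^(k^2) - 1) / (i k)], of norm at most
    [3/k] ([approximate_annihilator]).  As [Y] is [1 - b] with [b] in [B], it
    remains to see that [w = n Y] is small.  Since [w w^* w = (n Y h) Y^* Y] by
    commutativity of [B], its norm is at most [4] times that of [n Y h], which
    tends to [0]; and the C*-identity gives [|w|^4 <= |w| |w w^* w|]. *)

(** * Elementary C*-algebra identities *)

Section CstarBasics.
Context {R : realType} {A : cstarAlgType R}.
Implicit Types (x y z a b n : A) (c : R[i]).

Lemma cmul0r x : 0 ** x = 0.
Proof. by apply: (@addrI _ (0 ** x)); rewrite -cmulDl !addr0. Qed.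

Lemma cmulr0 x : x ** 0 = 0.
Proof. by apply: (@addrI _ (x ** 0)); rewrite -cmulDr !addr0. Qed.

Lemma cmulNr x y : (- x) ** y = - (x ** y).
Proof. by rewrite -scaleN1r -cscaleAl scaleN1r. Qed.

Lemma cmulrN x y : x ** (- y) = - (x ** y).
Proof. by rewrite -scaleN1r -cscaleAr scaleN1r. Qed.

Lemma cmulBl x y z : (x - y) ** z = x ** z - y ** z.
Proof. by rewrite cmulDl cmulNr. Qed.

Lemma cmulBr x y z : x ** (y - z) = x ** y - x ** z.
Proof. by rewrite cmulDr cmulrN. Qed.

Lemma star0 : star (0 : A) = 0.
Proof. by apply: (@addrI _ (star 0)); rewrite -starD !addr0. Qed.

Lemma starN x : star (- x) = - star x.
Proof. by rewrite -scaleN1r starZ rmorphN1 scaleN1r. Qed.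

Lemma starB x y : star (x - y) = star x - star y.
Proof. by rewrite starD starN. Qed.

Lemma star_norm x : `|star x| = `|x|.
Proof.
suff le_star y : `|y| <= `|star y|.
  by apply/eqP; rewrite eq_le le_star andbT -{2}[x]starK le_star.
have [->|y0] := eqVneq y 0; first by rewrite star0.
have := normcM_le (star y) y; rewrite cstar_identity expr2.
by rewrite ler_pM2r // normr_gt0.
Qed.

Lemma cstar_identityr x : `|x ** star x| = `|x| ^+ 2.
Proof. by rewrite -(star_norm x) -cstar_identity starK. Qed.

Lemma closedP_norm (M : set A) :
  closed M <-> (forall x, (forall e : R[i], 0 < e ->
                   exists2 y, M y & `|x - y| < e) -> M x).
Proof.
split=> [Mcl x Mx|Mcl].
  apply: Mcl => U /nbhs_ballP[e /= e0 eU].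
  by have [y My xy] := Mx e e0; exists y; split=> //; apply: eU; rewrite -ball_normE.
move=> x xM; apply: Mcl => e e0.
have [|y [My]] := xM (ball x e); first exact: nbhsx_ballx.
by rewrite -ball_normE; exists y.
Qed.

End CstarBasics.

Lemma addrDB2 (V : zmodType) (p q r t : V) : p + q + (r + t) - p - t = q + r.
Proof. by rewrite addrA [LHS]addrAC addrK -(addrA p) addrAC subrr add0r. Qed.

Lemma half_scale2 (K : numFieldType) (V : lmodType K) (v : V) :
  2^-1 *: (v + v) = v.
Proof. by rewrite scalerDr -scalerDl -[2^-1]mul1r -splitr scale1r. Qed.

(** * Polarization *)

Section Polarization.
Context {R : realType} {A : cstarAlgType R}.

(** The mixed terms [d x^* y + d^* y^* x] of the square of [x + d y] remain after
    subtracting the squares of [x] and [d y], and the values [d = 1] and [d = i]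
    separate [x^* y] from [y^* x]. *)
Lemma polarization (M : set A) (x y : A) : cstar_subalgebra M ->
    (forall c d : R[i], M (star (c *: x + d *: y) ** (c *: x + d *: y))) ->
  M (star x ** y).
Proof.
move=> HM Msq.
have MB u v : M u -> M v -> M (u - v).
  move=> Mu Mv; apply: csubalgD => //.
  by rewrite -scaleN1r; apply: csubalgZ.
have Mcross d : M (d *: (star x ** y) + d^* *: (star y ** x)).
  have := MB _ _ (MB _ _ (Msq 1 d) (Msq 1 0)) (Msq 0 d).
  rewrite !scale1r !scale0r !addr0 !add0r !starD !starZ !cmulDl !cmulDr.
  by rewrite -!cscaleAl -!cscaleAr addrDB2.
have M2 := csubalgD HM (Mcross 1) (csubalgZ HM (- 'i) (Mcross 'i)).
rewrite scalerDr !scalerA rmorph1 !scale1r conjCi mulrNN in M2.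
rewrite mulNr -!expr2 sqrCi opprK scale1r scaleN1r addrACA subrr addr0 in M2.
have := csubalgZ HM 2^-1 M2.
by rewrite half_scale2.
Qed.

End Polarization.

(** * Ergodic means of an almost unitary element *)

Section ErgodicMeans.
Context {R : realType} {A : cstarAlgType R}.
Implicit Types (x y z a b n : A) (c : R[i]).

(** Right multiplication by [1 + u], available although [A] need not have a
    unit. *)
Definition shift_by (u z : A) := z + z ** u.

(** For [a] self-adjoint and [c] imaginary, the cross terms of
    [(1 + c a) (1 + c a)^*] cancel, so the first-order growth disappears. *)
Lemma shift_by_le a c z : star a = a -> c^* = - c ->
  `|shift_by (c *: a) z| ^+ 2 <= (1 + `|c| ^+ 2 * `|a| ^+ 2) * `|z| ^+ 2.
Proof.
move=> asa cc; rewrite -cstar_identityr /shift_by starD starM starZ asa cc.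
have -> : (z + z ** (c *: a)) ** (star z + (- c *: a) ** star z) =
          z ** star z + (z ** (c *: a)) ** star (z ** (c *: a)).
  rewrite starM starZ asa cc cmulDl !cmulDr -!addrA; congr (_ + _).
  have cancel : z ** (- c *: a ** star z) + z ** (c *: a) ** star z = 0.
    by rewrite scaleNr cmulNr cmulrN cmulA addNr.
  by rewrite addrA cancel add0r.
apply: (le_trans (ler_normD _ _)); rewrite !cstar_identityr mulrDl mul1r lerD2l.
rewrite -cscaleAr normrZ exprMn -mulrA ler_wpM2l ?exprn_ge0 // -exprMn.
by rewrite ler_pXn2r ?nnegrE ?mulr_ge0 // mulrC normcM_le.
Qed.

Lemma exp1D_le2 (K : numFieldType) (t : K) j :
  0 <= t -> j%:R * t <= 2^-1 -> (1 + t) ^+ j <= 2.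
Proof.
move=> t0 jt.
(* Bernoulli's inequality for powers of [1 / (1 + t)], which is at least
   [1 - t]. *)
have bern : (1 + t) ^+ j * (1 - j%:R * t) <= 1.
  elim: j {jt} => [|j IHj]; first by rewrite expr0 mul0r subr0 mul1r.
  apply: le_trans IHj; rewrite exprSr -mulrA ler_wpM2l ?exprn_ge0 ?addr_ge0 //.
  rewrite -natr1 -subr_ge0.
  rewrite (_ : _ - _ = (j%:R + 1) * t ^+ 2); last by ring.
  by rewrite mulr_ge0 ?addr_ge0 ?exprn_ge0.
have := le_trans (ler_wpM2l (_ : 0 <= (1 + t) ^+ j) (_ : 2^-1 <= 1 - j%:R * t)) bern.
rewrite ler_pdivrMr ?ltr0n // mul1r; apply; first by rewrite exprn_ge0 ?addr_ge0.
by rewrite lerBrDr -lerBrDl (_ : 1 - 2^-1 = 2^-1) // {1}[1]splitr mul1r addrK.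
Qed.

Lemma iter_shift_by_le a c j z : star a = a -> c^* = - c ->
    j%:R * (`|c| ^+ 2 * `|a| ^+ 2) <= 2^-1 ->
  `|iter j (shift_by (c *: a)) z| <= 2 * `|z|.
Proof.
move=> asa cc jca; set t := _ * `|a| ^+ 2 in jca.
have t0 : 0 <= t by rewrite mulr_ge0 ?exprn_ge0.
have le_exp : `|iter j (shift_by (c *: a)) z| ^+ 2 <= (1 + t) ^+ j * `|z| ^+ 2.
  elim: j {jca} => [|j IHj]; first by rewrite expr0 mul1r.
  rewrite iterS (exprS (1 + t)) -mulrA; apply: (le_trans (shift_by_le _ asa cc)).
  by rewrite ler_wpM2l ?addr_ge0.
rewrite -(@ler_pXn2r _ 2) ?nnegrE ?mulr_ge0 //; apply: (le_trans le_exp).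
rewrite exprMn ler_wpM2r ?exprn_ge0 //; apply: (le_trans (exp1D_le2 t0 jca)).
by rewrite -natrX ler_nat.
Qed.

(** This and the next lemma produce [b] independent of [z]: the iterates act as
    multiplication by polynomials in [a] with constant term [1], and these have
    the form [1 - b] with [b] in any subalgebra containing [a]. *)
Lemma iter_shift_by_mul (M : set A) a j : cstar_subalgebra M -> M a ->
  exists2 b, M b & forall z, iter j (shift_by a) z = z - z ** b.
Proof.
move=> HM Ma; elim: j => [|j [b Mb IHj]].
  by exists 0 => [|z]; [exact: csubalg0 | rewrite cmulr0 subr0].
exists (b - a + b ** a) => [|z].
  apply: csubalgD => //; last exact: csubalgM.
  by apply: csubalgD => //; rewrite -scaleN1r; apply: csubalgZ.
rewrite iterS IHj /shift_by cmulBl !cmulDr cmulrN !cmulA !opprD opprK.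
by rewrite !addrA.
Qed.

Lemma sum_shift_by_mul (M : set A) a m : cstar_subalgebra M -> M a ->
  exists2 b, M b & forall z,
    \sum_(j < m) iter j (shift_by a) z = m%:R *: z - z ** b.
Proof.
move=> HM Ma; elim: m => [|m [b Mb IHm]].
  by exists 0 => [|z]; [exact: csubalg0 | rewrite big_ord0 cmulr0 scale0r subr0].
have [d Md iterE] := iter_shift_by_mul m HM Ma.
exists (b + d) => [|z]; first exact: csubalgD.
rewrite big_ord_recr /= IHm iterE cmulDr opprD -natr1 scalerDl scale1r.
by rewrite addrACA.
Qed.

Lemma telescope_shift_by a m z :
  (\sum_(j < m) iter j (shift_by a) z) ** a = iter m (shift_by a) z - z.
Proof.
elim: m => [|m IHm]; first by rewrite big_ord0 cmul0r subrr.
by rewrite big_ord_recr /= cmulDl IHm /shift_by addrAC.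
Qed.

(** The mean of the first [k^2] powers of [1 + (i/k) a].  The number of powers
    balances two effects: the powers stay bounded for exponents up to order
    [k^2], and telescoping gains the factor [k^2 * (1/k) = k]. *)
Lemma approximate_annihilator (M : set A) a (k : nat) : cstar_subalgebra M ->
    M a -> star a = a -> `|a| ^+ 2 <= 2^-1 -> (0 < k)%N ->
  exists2 b, M b & forall z,
    `|z - z ** b| <= 2 * `|z| /\ k%:R * `|(z - z ** b) ** a| <= 3 * `|z|.
Proof.
move=> HM Ma asa a2 k0.
have kn0 : k%:R != 0 :> R[i] by rewrite pnatr_eq0 -lt0n.
pose c : R[i] := 'i / k%:R; pose m := (k ^ 2)%N.
have mn0 : m%:R != 0 :> R[i] by rewrite pnatr_eq0 -lt0n expn_gt0 k0.
have cc : c^* = - c by rewrite /c rmorphM fmorphV rmorph_nat /= conjCi mulNr.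
have normc : `|c| = k%:R^-1 by rewrite /c normrM normCi mul1r normfV normr_nat.
have iter_le j z : (j <= m)%N -> `|iter j (shift_by (c *: a)) z| <= 2 * `|z|.
  move=> jm; apply: iter_shift_by_le => //; apply: le_trans a2.
  rewrite mulrA normc ler_piMl ?exprn_ge0 // exprVn -natrX.
  by rewrite ler_pdivrMr ?mul1r ?ler_nat // ltr0n expn_gt0 k0.
have [b Mb sumE] := sum_shift_by_mul m HM (csubalgZ HM c Ma).
have meanE z : z - z ** (m%:R^-1 *: b) =
               m%:R^-1 *: \sum_(j < m) iter j (shift_by (c *: a)) z.
  by rewrite sumE scalerBr scalerA mulVf // scale1r cscaleAr.
exists (m%:R^-1 *: b) => [|z]; first exact: csubalgZ.
split.
  rewrite meanE normrZ normfV normr_nat ler_pdivrMl ?ltr0n ?expn_gt0 ?k0 //.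
  apply: (le_trans (ler_norm_sum _ _ _)).
  apply: (@le_trans _ _ (\sum_(j < m) 2 * `|z|)).
    by apply: ler_sum => j _; apply/iter_le/ltnW.
  by rewrite sumr_const card_ord -[_ *+ m]mulr_natl.
have cn0 : c != 0 by rewrite -normr_eq0 normc invr_eq0.
have -> : (z - z ** (m%:R^-1 *: b)) ** a =
          (c^-1 / m%:R) *: (iter m (shift_by (c *: a)) z - z).
  rewrite meanE -telescope_shift_by -cscaleAl -cscaleAr scalerA.
  by rewrite mulrAC mulVf // mul1r.
rewrite normrZ normrM !normfV normc invrK normr_nat mulrA /m natrX.
rewrite mulrA -expr2 divff ?expf_neq0 // mul1r.
apply: (le_trans (ler_normB _ _)).
by rewrite (natrD _ 2 1) mulrDl mul1r lerD2r iter_le.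
Qed.

End ErgodicMeans.

(** * Approximate units *)

Section ApproximateUnits.
Context {R : realType} {A : cstarAlgType R}.
Implicit Types (x y z a b n : A) (c : R[i]).

Lemma natr_gt_norm (x : R[i]) : exists2 k : nat, (0 < k)%N & `|x| < k%:R.
Proof.
exists (Num.truncn (complex.Re `|x|)).+1 => //.
have -> : `|x| = (complex.Re `|x|)%:C%C by rewrite normc_def.
rewrite -(rmorph_nat (real_complex R)) ltcR.
exact: Num.Theory.truncnS_gt.
Qed.

(** A normal element [y] has [y y^* = y^* y], so [z y] and [z y^*] have the same
    norm; here [y = 1 - b]. *)
Lemma norm_sub_mul_star b z : star b ** b = b ** star b ->
  `|z - z ** star b| = `|z - z ** b|.
Proof.
move=> bn; apply/eqP; rewrite -(@eqrXn2 _ 2) //; apply/eqP.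
rewrite -!cstar_identityr !starB !starM starK.
rewrite !(cmulBl, cmulBr) !cmulA; rewrite -!(cmulA z) bn.
by congr (`|_|); rewrite !opprB addrACA [RHS]addrACA; congr (_ + _); rewrite addrC.
Qed.

(** The element [b] is built from the self-adjoint [h = n^* n] alone, rescaled to
    satisfy the norm bound of [approximate_annihilator].  That lemma controls
    [(n - n b) h]; the C*-identity then controls [n - n b] itself, with
    [k eta |n - n b|^4 <= 24 |n|^2]. *)
Lemma approximate_unit (M : set A) n : cstar_subalgebra M ->
    (forall a b, M a -> M b -> a ** b = b ** a) -> M (star n ** n) ->
  forall e : R[i], 0 < e -> exists2 b, M b & `|n - n ** b| < e.
Proof.
move=> HM comM Mh e e0; set h := star n ** n in Mh.
have h1 : 0 < 1 + `|h| by rewrite ltr_wpDr.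
pose eta := (2 * (1 + `|h|))^-1.
have eta0 : 0 < eta by rewrite invr_gt0 mulr_gt0.
have etaR : eta \is Num.real by rewrite ger0_real ?ltW.
have ash : star (eta *: h) = eta *: h by rewrite starZ starM starK (CrealP etaR).
have ah : `|eta *: h| <= 2^-1.
  rewrite normrZ gtr0_norm // /eta invfM -mulrA ler_piMr ?invr_ge0 //.
  by rewrite ler_pdivrMl // mulr1 lerDr.
have ah2 : `|eta *: h| ^+ 2 <= 2^-1.
  apply: (@le_trans _ _ (2^-1 * 2^-1)); first by rewrite expr2 ler_pM.
  by rewrite ler_piMr ?invr_ge0 // invf_le1 ?ler1n.
have [k k0 kB] := natr_gt_norm (24 * `|n| ^+ 2 / (eta * e ^+ 4)).
have [b Mb Hb] := approximate_annihilator HM (csubalgZ HM eta Mh) ash ah2 k0.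
exists b => //; set w := n - n ** b.
have [wn wa] : `|w| <= 2 * `|n| /\ k%:R * `|w ** (eta *: h)| <= 3 * `|n| by exact: Hb.
have Mbs : M (star b) by exact: csubalg_star.
have wwE : star w ** w = (h - h ** b) - (h - h ** b) ** star b.
  rewrite /w starB starM cmulBl !cmulBr !cmulBl !cmulA -!(cmulA _ (star n)) -/h.
  by rewrite (comM (star b) h) // -!(cmulA h) (comM (star b) b).
(* [w w^* w] is [w h (1 - b) (1 - b)^*]; right multiplication by each of the last
   two factors increases norms by at most the factor 2. *)
have www : `|w ** (star w ** w)| <= 4 * `|w ** h|.
  rewrite wwE cmulBr [w ** (_ ** star b)]cmulA cmulBr [w ** (h ** b)]cmulA.
  rewrite norm_sub_mul_star; last exact: comM.
  apply: (le_trans (proj1 (Hb _))); rewrite (natrM _ 2 2) -mulrA ler_wpM2l //.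
  by have [] := Hb (w ** h).
have w4 : `|w| ^+ 4 <= `|w| * (4 * `|w ** h|).
  rewrite (exprM _ 2 2) -cstar_identity -cstar_identity starM starK -cmulA.
  apply: (le_trans (normcM_le _ _)); rewrite star_norm ler_wpM2l //.
have kw4 : k%:R * eta * `|w| ^+ 4 <= 24 * `|n| ^+ 2.
  apply: (le_trans (ler_wpM2l _ w4)); first by rewrite mulr_ge0 ?ler0n ?(ltW eta0).
  rewrite -cscaleAr normrZ gtr0_norm // in wa.
  rewrite [leLHS](_ : _ = 4 * (`|w| * (k%:R * (eta * `|w ** h|)))); last by ring.
  apply: (@le_trans _ _ (4 * (2 * `|n| * (3 * `|n|)))).
    by rewrite ler_wpM2l // ler_pM // !mulr_ge0 // ltW.
  by rewrite le_eqVlt; apply/orP; left; apply/eqP; ring.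
rewrite ger0_norm in kB; last first.
  by rewrite divr_ge0 ?mulr_ge0 ?exprn_ge0 // ltW.
rewrite ltr_pdivrMr ?mulr_gt0 ?exprn_gt0 // in kB.
have := le_lt_trans kw4 kB; rewrite -mulrA !ltr_pM2l ?ltr0n //.
by rewrite ltr_pXn2r ?nnegrE // ltW.
Qed.

End ApproximateUnits.

(** * The semi-Cartan subalgebra of a Cartan semigroup *)

Section CartanLemmas.
Context {R : realType} {A : cstarAlgType R}.

Lemma cstar_generated_subalgebra (S : set A) :
  cstar_subalgebra (cstar_generated S).
Proof.
split=> [M [HM _]|x y Sx Sy M HM|c x Sx M HM|x y Sx Sy M HM|x Sx M HM|].
- exact: csubalg0.
- by apply: csubalgD (Sx M HM) (Sy M HM); case: HM.
- by apply: csubalgZ (Sx M HM); case: HM.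
- by apply: csubalgM (Sx M HM) (Sy M HM); case: HM.
- by apply: csubalg_star (Sx M HM); case: HM.
- apply: closed_bigI => M [HM _]; exact: csubalg_closed.
Qed.

Lemma closed_sandwich (B : set A) (m : A) :
  closed B -> closed [set b | B (star m ** b ** m)].
Proof.
move=> /closedP_norm Bcl; apply/closedP_norm => x /= approx.
apply: Bcl => e e0.
have m0 : 0 < `|m| ^+ 2 + 1 by rewrite ltr_wpDl ?exprn_ge0.
have [y By xy] := approx (e / (`|m| ^+ 2 + 1)) (divr_gt0 e0 m0).
exists (star m ** y ** m) => //.
rewrite -cmulBl -cmulBr; apply: le_lt_trans (normcM_le _ _) _.
apply: (@le_lt_trans _ _ (`|x - y| * `|m| ^+ 2)).
  rewrite expr2 mulrA ler_wpM2r // mulrC.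
  by rewrite -[`|m|]star_norm normcM_le.
rewrite ltr_pdivlMr // in xy; apply: le_lt_trans xy.
by rewrite ler_wpM2l // lerDl.
Qed.

(** Minimality of [B], applied to the set of [c] in [B] for which the claim holds
    for all [n] at once. *)
Lemma sandwich_semi_cartan (N : set A) (n b : A) : cartan_semigroup N ->
  N n -> semi_cartan N b -> semi_cartan N (star n ** b ** n).
Proof.
move=> HN Nn Bb; set B := semi_cartan N.
have HB : cstar_subalgebra B := cstar_generated_subalgebra _.
have sqB m : N m -> B (star m ** m) by move=> Nm; apply: sub_gen_smallest; exists m.
pose T := [set c | B c /\ forall m, N m -> B (star m ** c ** m)].
suff HT : cstar_subalgebra T.
  have ST : star_squares N `<=` T.
    move=> _ [m Nm <-]; split=> [|p Np]; first exact: sqB.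
    have -> : star p ** (star m ** m) ** p = star (m ** p) ** (m ** p).
      by rewrite starM !cmulA.
    by apply: sqB; apply: cartanM.
  by have [_] := smallest_sub HT ST Bb; apply.
split=> [|x y [Bx Tx] [By Ty]|c x [Bx Tx]|x y [Bx Tx] [By Ty]|x [Bx Tx]|].
- by split=> [|m Nm]; rewrite ?cmulr0 ?cmul0r; exact: (csubalg0 HB).
- split=> [|m Nm]; first exact: (csubalgD HB).
  by rewrite cmulDr cmulDl; apply: (csubalgD HB); [exact: Tx | exact: Ty].
- split=> [|m Nm]; first exact: (csubalgZ HB).
  by rewrite -cscaleAr -cscaleAl; apply: (csubalgZ HB); exact: Tx.
- split=> [|m Nm]; first exact: (csubalgM HB).
  (* Membership of [x] and [y] in [B] suffices: polarize [(x^* m)^* (y m)]. *)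
  have -> : star m ** (x ** y) ** m = star (star x ** m) ** (y ** m).
    by rewrite starM starK !cmulA.
  apply: polarization => // c d; rewrite cscaleAl cscaleAl -cmulDl.
  apply: sqB; apply: cartanM => //; apply: cartan_sub => //.
  by apply: (csubalgD HB) => //; apply: (csubalgZ HB) => //; apply: (csubalg_star HB).
- split=> [|m Nm]; first exact: (csubalg_star HB).
  have -> : star m ** star x ** m = star (star m ** x ** m).
    by rewrite !starM starK cmulA.
  by apply: (csubalg_star HB) => //; exact: Tx.
- have -> : T = B `&` \bigcap_(m in N) [set c | B (star m ** c ** m)] by [].
  apply: closedI; first exact: (csubalg_closed HB).
  by apply: closed_bigI => m _; exact: closed_sandwich (csubalg_closed HB).
Qed.

Lemma cartan_scale (N : set A) (c : R[i]) (n : A) : cartan_semigroup N ->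
  N n -> N (c *: n).
Proof.
move=> HN Nn.
have HB := cstar_generated_subalgebra (star_squares N).
have /closedP_norm := cartan_closed HN; apply => e e0.
have Bh : semi_cartan N (star n ** n) by apply: sub_gen_smallest; exists n.
have c0 : 0 < `|c| + 1 by rewrite ltr_wpDl.
have [b Bb nb] := approximate_unit HB (cartan_comm HN) Bh (divr_gt0 e0 c0).
exists (n ** (c *: b)).
  by apply: cartanM => //; apply: cartan_sub => //; exact: (csubalgZ HB).
rewrite -cscaleAr -scalerBr normrZ mulrC.
rewrite ltr_pdivlMr // in nb; apply: le_lt_trans nb.
by rewrite ler_wpM2l // lerDl.
Qed.

End CartanLemmas.

Theorem lemma4p1 (R : realType) (A : cstarAlgType R) (N : set A)
    (HN : cartan_semigroup N) :
  (forall (alpha : R[i]) (n : A), N n ->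
     scale_set alpha (semi_cartan N) `|` sandwich (star n) (semi_cartan N) n
       `<=` semi_cartan N) /\
  complex_multiples N = N /\
  N `<=` normaliser (semi_cartan N).
Proof.
have HB := cstar_generated_subalgebra (star_squares N).
split=> [alpha n Nn _ [[b Bb <-]|[b Bb <-]]|].
- exact: (csubalgZ HB).
- exact: sandwich_semi_cartan.
split.
  apply/seteqP; split=> [_ [c _ [n Nn <-]]|n Nn]; first exact: cartan_scale.
  by exists 1 => //; exists n => //; rewrite scale1r.
move=> n Nn _ [[b Bb <-]|[b Bb <-]]; first exact: sandwich_semi_cartan.
rewrite -{1}[n]starK; apply: sandwich_semi_cartan => //.
exact: cartan_star.
Qed.
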